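(* For every integer $n\ge 5$, the Kneser graph $K(n,2)$ is $P_6$-induced-saturated.
   Context: The Kneser graph $K(n,r)$ has as vertices the $r$-element subsets of $\{1,2,\ldots,n\}$, two vertices being adjacent if and only if the corresponding subsets are disjoint. $P_k$ denotes the path on $k$ vertices. For a graph $H$, a graph $G$ is $H$-induced-saturated if $G$ does not contain an induced subgraph isomorphic to $H$, but for every edge $e$ of $G$ the graph $G-e$ contains an induced copy of $H$, and for every non-edge $e$ of $G$ the graph $G+e$ contains an induced copy of $H$. *)

(* Defs.v *)
From mathcomp Require Import all_boot.

Set Implicit Arguments.
Unset Strict Implicit.
Unset Printing Implicit Defensive.

Record sgraph (V : finType) := SGraph {
  adj :> rel V;
  adj_sym : symmetric adj;
  adj_irrefl : irreflexive adj
}.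

(* H is isomorphic to the subgraph of G induced on the image of f. *)
Definition has_induced_copy (U V : finType) (H : sgraph U) (G : sgraph V) : Prop :=
  exists f : U -> V, injective f /\ forall x y : U, G (f x) (f y) = H x y.

Section EdgeOperations.
Variables (V : finType) (G : sgraph V) (u v : V).

Definition del_adj : rel V :=
  fun x y => G x y && ([set x; y] != [set u; v]).

Lemma del_adj_sym : symmetric del_adj.
Proof. by move=> x y; rewrite /del_adj adj_sym setUC. Qed.

Lemma del_adj_irrefl : irreflexive del_adj.
Proof. by move=> x; rewrite /del_adj adj_irrefl. Qed.

Definition del_edge : sgraph V := SGraph del_adj_sym del_adj_irrefl.

(* The conjunct x != y matters only in the degenerate case u = v. *)
Definition add_adj : rel V :=
  fun x y => (x != y) && (G x y || ([set x; y] == [set u; v])).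

Lemma add_adj_sym : symmetric add_adj.
Proof. by move=> x y; rewrite /add_adj adj_sym setUC eq_sym. Qed.

Lemma add_adj_irrefl : irreflexive add_adj.
Proof. by move=> x; rewrite /add_adj eqxx. Qed.

Definition add_edge : sgraph V := SGraph add_adj_sym add_adj_irrefl.

End EdgeOperations.

Definition induced_saturated (U V : finType) (H : sgraph U) (G : sgraph V) : Prop :=
  [/\ ~ has_induced_copy H G,
      forall u v : V, G u v -> has_induced_copy H (del_edge G u v)
    & forall u v : V, u != v -> ~~ G u v -> has_induced_copy H (add_edge G u v)].

Definition path_adj (k : nat) : rel 'I_k :=
  fun i j => (i.+1 == j :> nat) || (j.+1 == i :> nat).

Lemma path_adj_sym (k : nat) : symmetric (@path_adj k).
Proof. by move=> i j; rewrite /path_adj orbC. Qed.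

Lemma path_adj_irrefl (k : nat) : irreflexive (@path_adj k).
Proof. by move=> i; rewrite /path_adj orbb eqn_leq ltnn. Qed.

Definition path_graph (k : nat) : sgraph 'I_k :=
  SGraph (@path_adj_sym k) (@path_adj_irrefl k).

Definition ksubset (n r : nat) : finType := {A : {set 'I_n} | #|A| == r}.

(* The conjunct A != B matters only for r = 0, where the sole vertex is
   disjoint from itself. *)
Definition kneser_adj (n r : nat) : rel (ksubset n r) :=
  fun A B => (A != B) && [disjoint val A & val B].

Lemma kneser_adj_sym (n r : nat) : symmetric (@kneser_adj n r).
Proof. by move=> A B; rewrite /kneser_adj eq_sym disjoint_sym. Qed.

Lemma kneser_adj_irrefl (n r : nat) : irreflexive (@kneser_adj n r).
Proof. by move=> A; rewrite /kneser_adj eqxx. Qed.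

Definition kneser (n r : nat) : sgraph (ksubset n r) :=
  SGraph (@kneser_adj_sym n r) (@kneser_adj_irrefl n r).

(* Main.v *)
Require Import Defs.
From mathcomp Require Import all_boot.

Set Implicit Arguments.
Unset Strict Implicit.
Unset Printing Implicit Defensive.

(** In an induced [P_2 + P_3] of [K(n,2)], with edge [A B] and path [C D E], each of
    [C], [D], [E] meets both [A] and [B], hence lies in the four-element set [A :|: B];
    then [C] and [E] both equal the complement of [D] there, a contradiction.
    As [P_6] contains [P_2 + P_3], it has no induced copy.  For the edge
    modifications, five labels suffice: up to relabelling there is one edge and one
    non-edge, and an explicit path on pairs of labels works in each case. *)

(** As [A] and [B] are disjoint, [C] meets them in different elements, and two elements exhaust
    [C]. *)
Lemma card2_subU (T : finType) (A B C : {set T}) :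
  #|C| = 2 -> [disjoint A & B] -> ~~ [disjoint C & A] -> ~~ [disjoint C & B] ->
  C \subset A :|: B.
Proof.
rewrite -!setI_eq0 => cC /eqP dAB nCA nCB.
have dI : (C :&: A) :&: (C :&: B) = set0 by rewrite setIACA dAB setI0.
have : #|C| <= #|C :&: (A :|: B)|.
  by rewrite setIUr cardsU dI cards0 subn0 cC (@leq_add 1 1) // card_gt0.
by move=> le; apply/setIidPl/eqP; rewrite eqEcard subsetIl.
Qed.

Lemma disjoint_card2_compl (T : finType) (U C D : {set T}) :
  #|U| = 4 -> #|C| = 2 -> #|D| = 2 -> C \subset U -> D \subset U ->
  [disjoint C & D] -> C = U :\: D.
Proof.
move=> cU cC cD sC sD dCD; apply/eqP; rewrite eqEcard subsetD sC dCD /=.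
by rewrite cardsD (setIidPr sD) cU cC cD.
Qed.

Lemma kneser2_no_P6 (n : nat) : ~ has_induced_copy (path_graph 6) (kneser n 2).
Proof.
case=> f [f_inj fE]; pose e k : {set 'I_n} := val (f (inord k)).
have c2 k : #|e k| = 2 by apply/eqP/(valP (f _)).
have eE i j : i < 6 -> j < 6 -> i != j ->
    [disjoint e i & e j] = (i.+1 == j) || (j.+1 == i).
  move=> i6 j6 nij; have := fE (inord i) (inord j).
  rewrite /= /kneser_adj /path_adj !inordK // => <-.
  by rewrite (inj_eq f_inj) -val_eqE /= !inordK // nij.
have e35 : e 3 <> e 5 by move=> /val_inj/f_inj/(congr1 val); rewrite /= !inordK.
(* Otherwise unification unfolds [inord] when comparing [e i] with [e j]. *)
clearbody e.
(* Dropping vertex 2 of the path leaves the edge 0, 1 and the path 3, 4, 5, with no edges between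
   them. *)
have d01 : [disjoint e 0 & e 1] by rewrite eE.
have sU k : 2 < k < 6 -> e k \subset e 0 :|: e 1.
  by case: k => [|[|[|[|[|[|k]]]]]] // _; apply: card2_subU; rewrite ?eE.
have cU : #|e 0 :|: e 1| = 4.
  by move: d01; rewrite -setI_eq0 cardsU !c2 => /eqP->; rewrite cards0.
have d34 : [disjoint e 3 & e 4] by rewrite eE.
have d54 : [disjoint e 5 & e 4] by rewrite eE.
apply: e35; rewrite (disjoint_card2_compl cU (c2 3) (c2 4) (sU 3 isT) (sU 4 isT) d34).
by rewrite (disjoint_card2_compl cU (c2 5) (c2 4) (sU 5 isT) (sU 4 isT) d54).
Qed.

Lemma eq_set2 (T : finType) (x y u v : T) :
  ([set x; y] == [set u; v]) = (x == u) && (y == v) || (x == v) && (y == u).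
Proof.
apply/eqP/idP => [/setP E | /orP[] /andP[/eqP-> /eqP->] //]; last exact: setUC.
(* Comparing membership at the four named elements suffices: what remains is propositional in the
   four equalities between [x], [y] and [u], [v]. *)
move: (E x) (E y) (E u) (E v); rewrite !inE !eqxx ?orbT /=.
rewrite [u == x]eq_sym [u == y]eq_sym [v == x]eq_sym [v == y]eq_sym.
by do 4 case: (_ == _).
Qed.

Lemma disjoint_set2 (T : finType) (x y u v : T) :
  [disjoint [set x; y] & [set u; v]] = [&& x != u, x != v, y != u & y != v].
Proof. by rewrite -setI_eq0 setIUl setU_eq0 !setI_eq0 !disjoints1 !inE !negb_or -andbA. Qed.

(** * Vertices coded by pairs of labels *)

Definition valid_code (p : nat * nat) := [&& p.1 < 5, p.2 < 5 & p.1 != p.2].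

(** A code is an ordered pair of label positions, but the vertex it stands for is unordered, so
    swapped codes are identified. *)
Definition eq_code (p q : nat * nat) :=
  (p.1 == q.1) && (p.2 == q.2) || (p.1 == q.2) && (p.2 == q.1).

Definition disj_code (p q : nat * nat) :=
  [&& p.1 != q.1, p.1 != q.2, p.2 != q.1 & p.2 != q.2].

Definition eq_code2 (p q u v : nat * nat) :=
  eq_code p u && eq_code q v || eq_code p v && eq_code q u.

Definition del_code (u v p q : nat * nat) := disj_code p q && ~~ eq_code2 p q u v.

Definition add_code (u v p q : nat * nat) :=
  ~~ eq_code p q && (disj_code p q || eq_code2 p q u v).

(** A Boolean test that evaluates to [true] on a concrete list, so a witness path is checked by
    computation. The indices stay below [size t], so the default [(0, 1)] is never read. *)
Definition is_path_code (r : rel (nat * nat)) (t : seq (nat * nat)) :=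
  all (fun i => valid_code (nth (0, 1) t i) &&
    all (fun j => (eq_code (nth (0, 1) t i) (nth (0, 1) t j) == (i == j)) &&
      (r (nth (0, 1) t i) (nth (0, 1) t j) == ((i.+1 == j) || (j.+1 == i))))
      (iota 0 (size t))) (iota 0 (size t)).

Section Codes.
Variables (n : nat) (x0 : 'I_n) (s : seq 'I_n) (w : ksubset n 2).
Hypotheses (s_uniq : uniq s) (s_size : size s = 5).

Definition label k := nth x0 s k.

(* The default value [w] is returned only on invalid codes. *)
Definition vert (p : nat * nat) : ksubset n 2 := insubd w [set label p.1; label p.2].

Lemma label_eq i j : i < 5 -> j < 5 -> (label i == label j) = (i == j).
Proof. by rewrite -s_size => i5 j5; apply: nth_uniq. Qed.

Lemma val_vert p : valid_code p -> val (vert p) = [set label p.1; label p.2].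
Proof.
by case/and3P=> p1 p2 np; rewrite val_insubd cards2 label_eq // np.
Qed.

Lemma vert_val p (u : ksubset n 2) :
  valid_code p -> val u = [set label p.1; label p.2] -> vert p = u.
Proof. by move=> vp uE; apply: val_inj; rewrite val_vert. Qed.

Lemma vert_eq p q : valid_code p -> valid_code q -> (vert p == vert q) = eq_code p q.
Proof.
move=> vp vq; rewrite -val_eqE /= !val_vert // eq_set2.
by case/and3P: vp vq => ? ? _ /and3P[? ? _]; rewrite !label_eq.
Qed.

Lemma kneser_vert p q :
  valid_code p -> valid_code q -> kneser n 2 (vert p) (vert q) = disj_code p q.
Proof.
move=> vp vq; rewrite /= /kneser_adj vert_eq // !val_vert // disjoint_set2.
case/and3P: vp vq => ? ? _ /and3P[? ? _]; rewrite !label_eq //.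
by rewrite /eq_code /disj_code; do 4 case: (_ == _).
Qed.

Lemma vert_eq2 p q u v :
  valid_code p -> valid_code q -> valid_code u -> valid_code v ->
  ([set vert p; vert q] == [set vert u; vert v]) = eq_code2 p q u v.
Proof. by move=> *; rewrite eq_set2 !vert_eq. Qed.

Lemma del_edge_vert u v p q :
  valid_code u -> valid_code v -> valid_code p -> valid_code q ->
  del_edge (kneser n 2) (vert u) (vert v) (vert p) (vert q) = del_code u v p q.
Proof. by move=> *; rewrite /= /del_adj kneser_vert // vert_eq2. Qed.

Lemma add_edge_vert u v p q :
  valid_code u -> valid_code v -> valid_code p -> valid_code q ->
  add_edge (kneser n 2) (vert u) (vert v) (vert p) (vert q) = add_code u v p q.
Proof. by move=> *; rewrite /= /add_adj kneser_vert // vert_eq2 // vert_eq. Qed.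

(** Of the two clauses of the test, the one on [eq_code] gives injectivity and the one on [r] gives
    the adjacencies. *)
Lemma path_code_induced (G : sgraph (ksubset n 2)) (r : rel (nat * nat)) t :
  (forall p q, valid_code p -> valid_code q -> G (vert p) (vert q) = r p q) ->
  is_path_code r t -> has_induced_copy (path_graph (size t)) G.
Proof.
move=> Gr /allP tP; exists (fun i : 'I_(size t) => vert (nth (0, 1) t i)).
have in_t (i : 'I_(size t)) : val i \in iota 0 (size t) by rewrite mem_iota /=.
have tV (i : 'I_(size t)) : valid_code (nth (0, 1) t (val i)) by case/andP: (tP _ (in_t i)).
have tE (i j : 'I_(size t)) := allP (proj2 (andP (tP _ (in_t i)))) _ (in_t j).
split=> [i j /eqP | i j]; case/andP: (tE i j) => /eqP e1 /eqP e2.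
  rewrite vert_eq ?tV // [eq_code _ _]e1 => /eqP; exact: val_inj.
by rewrite Gr ?tV.
Qed.

Lemma del_edge_path_code u v t :
  valid_code u -> valid_code v -> is_path_code (del_code u v) t ->
  has_induced_copy (path_graph (size t)) (del_edge (kneser n 2) (vert u) (vert v)).
Proof. by move=> vu vv; apply: path_code_induced => p q; apply: del_edge_vert. Qed.

Lemma add_edge_path_code u v t :
  valid_code u -> valid_code v -> is_path_code (add_code u v) t ->
  has_induced_copy (path_graph (size t)) (add_edge (kneser n 2) (vert u) (vert v)).
Proof. by move=> vu vv; apply: path_code_induced => p q; apply: add_edge_vert. Qed.

End Codes.

(** Serves to complete the labels occurring in two given vertices to five distinct ones, which is
    where [5 <= n] enters. *)
Lemma uniq_extend (T : finType) (s : seq T) (m : nat) :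
  uniq s -> size s + m <= #|T| ->
  exists t, uniq (s ++ t) /\ size t = m.
Proof.
elim: m s => [|m IHm] s us; first by exists [::]; rewrite cats0.
rewrite addnS => lt_sT.
have [x xs] : exists x, x \notin s.
  apply/existsP; rewrite -negb_forall; apply/negP => /forallP sT.
  have := leq_ltn_trans (leq_addr m _) lt_sT; rewrite -(card_uniqP us) ltnNge.
  by rewrite subset_leq_card //; apply/subsetP=> x _; apply: sT.
have [|| t [ut <-]] := IHm (rcons s x); rewrite ?rcons_uniq ?xs ?size_rcons //.
by exists (x :: t); rewrite -cat_rcons.
Qed.

Lemma ksubset2_mem (n : nat) (u : ksubset n 2) a :
  a \in val u -> exists2 b, a != b & val u = [set a; b].
Proof.
have /cards2P[x [y [nxy ->]]] := valP u; rewrite !inE => /orP[] /eqP->.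
  by exists y.
by exists x; rewrite 1?eq_sym // setUC.
Qed.

Lemma kneser2_del_edge_P6 (n : nat) (u v : ksubset n 2) :
  5 <= n -> kneser n 2 u v ->
  has_induced_copy (path_graph 6) (del_edge (kneser n 2) u v).
Proof.
move=> hn /andP[_]; have /cards2P[a [b [nab uE]]] := valP u.
have /cards2P[c [d [ncd vE]]] := valP v.
rewrite uE vE disjoint_set2 => /and4P[nac nad nbc nbd].
have us : uniq [:: a; b; c; d].
  by rewrite /= !inE !negb_or nab nac nad nbc nbd ncd.
have [|t [ut tS]] := uniq_extend (m := 1) us; first by rewrite card_ord.
set s := _ ++ t in ut; have s5 : size s = 5 by rewrite size_cat tS.
have uV : vert a s u (0, 1) = u by apply: vert_val.
have vV : vert a s u (2, 3) = v by apply: vert_val.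
rewrite -[X in del_edge _ X]uV -[X in del_edge _ _ X]vV.
(* In the Kneser graph these six vertices form an induced 6-cycle through the edge from [(0, 1)] to
   [(2, 3)]; deleting that edge opens it into a path. *)
exact: (@del_edge_path_code _ a s u ut s5 (0, 1) (2, 3)
  [:: (0, 1); (2, 4); (0, 3); (1, 2); (0, 4); (2, 3)]).
Qed.

Lemma kneser2_add_edge_P6 (n : nat) (u v : ksubset n 2) :
  5 <= n -> u != v -> ~~ kneser n 2 u v ->
  has_induced_copy (path_graph 6) (add_edge (kneser n 2) u v).
Proof.
move=> hn nuv nadj; have nd : ~~ [disjoint val u & val v].
  by move: nadj; rewrite /= /kneser_adj nuv.
(* Distinct non-adjacent vertices share exactly one label [a], so together they use three labels and
   two more are needed. *)
have /set0Pn[a] : val u :&: val v != set0 by rewrite setI_eq0.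
rewrite inE => /andP[au av].
have [b nab uE] := ksubset2_mem au; have [c nac vE] := ksubset2_mem av.
have nbc : b != c by apply: contraNneq nuv => bc; rewrite -val_eqE /= uE vE bc.
have us : uniq [:: a; b; c] by rewrite /= !inE negb_or nab nac nbc.
have [|t [ut tS]] := uniq_extend (m := 2) us; first by rewrite card_ord.
set s := _ ++ t in ut; have s5 : size s = 5 by rewrite size_cat tS.
have uV : vert a s u (0, 1) = u by apply: vert_val.
have vV : vert a s u (0, 2) = v by apply: vert_val.
rewrite -[X in add_edge _ X]uV -[X in add_edge _ _ X]vV.
(* The last five vertices already induce a path in the Kneser graph, and [(0, 1)] meets each of
   them; the new edge attaches it to the end [(0, 2)]. *)
exact: (@add_edge_path_code _ a s u ut s5 (0, 1) (0, 2)
  [:: (0, 1); (0, 2); (1, 3); (0, 4); (1, 2); (0, 3)]).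
Qed.

Theorem theorem1p4 (n : nat) (hn : 5 <= n) :
  induced_saturated (path_graph 6) (kneser n 2).
Proof.
split; first exact: kneser2_no_P6.
- by move=> u v; apply: kneser2_del_edge_P6.
- by move=> u v; apply: kneser2_add_edge_P6.
Qed.
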